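(* Let $k$ be a positive rational with $k<3$ and $\varepsilon$ a positive real with $\varepsilon\ge\frac{1}{k+\varepsilon}$. If $G$ is a fractionally $k$-colorable graph and $W\subseteq V(G)$ is a set of vertices at pairwise distance at least six, then every fractional $(k+\varepsilon)$-precoloring of $W$ extends to a fractional $(k+\varepsilon)$-coloring of $G$.
   Context: A fractional $m$-coloring of a graph (real $m>0$) assigns to each vertex a measurable subset of $[0,m)$ of Lebesgue measure one so that adjacent vertices receive disjoint sets; a graph is fractionally $k$-colorable if it has a fractional $k$-coloring. A fractional $m$-precoloring of a vertex set $W$ assigns measurable subsets of $[0,m)$ of measure one to the vertices of $W$; it extends if some fractional $m$-coloring of the whole graph agrees with it on $W$. Graphs are finite. *)

(* Defs.v *)
From Stdlib Require Import Reals QArith Qreals List.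
Open Scope R_scope.

Definition Rset := R -> Prop.

Definition interval_cover_le (A : Rset) (a b : nat -> R) (s : R) : Prop :=
  (forall n, a n <= b n) /\
  (forall x, A x -> exists n, a n < x /\ x < b n) /\
  (forall N, sum_f_R0 (fun n => b n - a n) N <= s).

Definition outer_le (A : Rset) (r : R) : Prop :=
  forall d, 0 < d -> exists a b, interval_cover_le A a b (r + d).

Definition outer_eq (A : Rset) (r : R) : Prop :=
  outer_le A r /\ forall r', outer_le A r' -> r <= r'.

(* Caratheodory measurability: outer(E∩A) + outer(E\A) <= outer(E) for all E
   (the reverse inequality always holds; infinite outer(E) trivial). *)
Definition lebesgue_measurable (A : Rset) : Prop :=
  forall (E : Rset) r, outer_le E r ->
    exists r1 r2, r1 + r2 <= r /\
      outer_le (fun x => E x /\ A x) r1 /\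
      outer_le (fun x => E x /\ ~ A x) r2.

Definition unit_set (m : R) (A : Rset) : Prop :=
  (forall x, A x -> 0 <= x /\ x < m) /\
  lebesgue_measurable A /\ outer_eq A 1.

Record graph := {
  vtx : Type;
  adj : vtx -> vtx -> Prop;
  vtx_finite : exists l : list vtx, forall v, In v l;
  adj_sym : forall u v, adj u v -> adj v u;
  adj_irrefl : forall v, ~ adj v v
}.

Inductive walk (G : graph) : nat -> vtx G -> vtx G -> Prop :=
| walk_nil : forall x, walk G 0 x x
| walk_cons : forall n x y z, adj G x y -> walk G n y z -> walk G (S n) x z.

Definition dist_ge (G : graph) (x y : vtx G) (d : nat) : Prop :=
  forall n, walk G n x y -> (d <= n)%nat.

Definition frac_coloring (G : graph) (m : R) (c : vtx G -> Rset) : Prop :=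
  (forall v, unit_set m (c v)) /\
  (forall u v, adj G u v -> forall x, ~ (c u x /\ c v x)).

Definition frac_colorable (G : graph) (m : R) : Prop :=
  exists c, frac_coloring G m c.

Definition frac_precoloring (G : graph) (m : R) (W : vtx G -> Prop)
    (p : vtx G -> Rset) : Prop :=
  forall v, W v -> unit_set m (p v).

Definition precoloring_extends (G : graph) (m : R) (W : vtx G -> Prop)
    (p : vtx G -> Rset) : Prop :=
  exists c, frac_coloring G m c /\
    forall v, W v -> forall x, c v x <-> p v x.

(* Main.v *)
(** Let [m = k + eps].  An edge forces [2 <= k] and a triangle forces [3 <= k],
    so either there are no edges or [2 <= m], and neighborhoods are independent.
    First copy the given [k]-coloring into [[0, m)], statistically independently
    of all the sets [p w], so that every color set meets every [p w] in measure
    [1/m] and a set of measure [eps] stays unused.  For [w] in [W] choose inside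
    [c w \ p w] a set [A] of measure [1/m <= eps].  Vertices at distance two from
    [w] exchange their part of [A] for unused colors; this frees [A] for the
    neighbors of [w], which use it instead of the measure [1/m] they share with
    [p w].  Since the neighborhood of [w] is independent no conflict arises, and
    distance six keeps different recolorings apart. *)

Require Import Defs.
From Stdlib Require Import Reals QArith Qreals.
From Stdlib Require Import Lra Lia List Classical ClassicalEpsilon.
From Stdlib Require Import FunctionalExtensionality PropExtensionality.
Open Scope R_scope.

Local Notation Rset := Defs.Rset.

(** * Boolean operations on sets of reals *)

Definition setI (A B : Rset) : Rset := fun x => A x /\ B x.
Definition setD (A B : Rset) : Rset := fun x => A x /\ ~ B x.
Definition setU (A B : Rset) : Rset := fun x => A x \/ B x.
Definition subset (A B : Rset) : Prop := forall x, A x -> B x.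
Definition disjoint (A B : Rset) : Prop := forall x, ~ (A x /\ B x).
Definition Iio (t : R) : Rset := fun x => x < t.
Definition Ico (s t : R) : Rset := fun x => s <= x /\ x < t.

Lemma set_ext (A B : Rset) : (forall x, A x <-> B x) -> A = B.
Proof.
  intros H; apply functional_extensionality; intros x.
  apply propositional_extensionality, H.
Qed.

Ltac set_eq :=
  apply set_ext; let x := fresh "x" in intros x;
  unfold setI, setD, setU, Iio, Ico in *; try tauto.

(** * Lebesgue outer measure *)

Lemma sum_nonneg_mono (f : nat -> R) (N M : nat) :
  (forall n, 0 <= f n) -> (N <= M)%nat -> sum_f_R0 f N <= sum_f_R0 f M.
Proof.
  intros Hf; induction 1 as [|M _ IH]; [lra|].
  simpl; specialize (Hf (S M)); lra.
Qed.

Lemma outer_le_mono (A B : Rset) (r s : R) :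
  subset A B -> r <= s -> outer_le B r -> outer_le A s.
Proof.
  intros HAB Hrs HB d Hd.
  destruct (HB d Hd) as (a & b & H1 & H2 & H3).
  exists a, b; repeat split; auto.
  intros N; specialize (H3 N); lra.
Qed.

Lemma outer_le_nonneg (A : Rset) (r : R) : outer_le A r -> 0 <= r.
Proof.
  intros H; apply Rnot_lt_le; intros Hr.
  destruct (H (- r / 2) ltac:(lra)) as (a & b & H1 & _ & H3).
  specialize (H1 0%nat); specialize (H3 0%nat); simpl in H3; lra.
Qed.

Definition interleave {T : Type} (a b : nat -> T) (n : nat) : T :=
  if Nat.even n then a (Nat.div2 n) else b (Nat.div2 n).

Lemma interleave_even {T : Type} (a b : nat -> T) (n : nat) :
  interleave a b (2 * n) = a n.
Proof.
  unfold interleave.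
  now rewrite Nat.even_mul, Nat.div2_double.
Qed.

Lemma interleave_odd {T : Type} (a b : nat -> T) (n : nat) :
  interleave a b (S (2 * n)) = b n.
Proof.
  unfold interleave.
  now rewrite Nat.even_succ, Nat.odd_mul, Nat.div2_succ_double.
Qed.

Lemma interleave_elim {T : Type} (P : T -> Prop) (a b : nat -> T) :
  (forall n, P (a n)) -> (forall n, P (b n)) -> forall n, P (interleave a b n).
Proof. intros Ha Hb n; unfold interleave; destruct (Nat.even n); auto. Qed.

Lemma sum_interleave (f g : nat -> R) (N : nat) :
  sum_f_R0 (interleave f g) (S (2 * N)) = sum_f_R0 f N + sum_f_R0 g N.
Proof.
  induction N as [|N IH]; [reflexivity|].
  replace (S (2 * S N)) with (S (S (S (2 * N)))) by lia.
  rewrite !(tech5 _ (S _)), IH, (tech5 f), (tech5 g).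
  replace (S (S (2 * N))) with (2 * S N)%nat by lia.
  rewrite interleave_even, interleave_odd; lra.
Qed.

(** Two covers with slack [d / 2] each are interleaved into one sequence; its partial sum up to [N]
    is at most the one up to [2 * N + 1], which splits into a partial sum of each cover. *)
Lemma outer_le_union (A B : Rset) (r s : R) :
  outer_le A r -> outer_le B s -> outer_le (setU A B) (r + s).
Proof.
  intros HA HB d Hd.
  destruct (HA (d / 2) ltac:(lra)) as (a & b & A1 & A2 & A3).
  destruct (HB (d / 2) ltac:(lra)) as (a' & b' & B1 & B2 & B3).
  assert (Hdiff : (fun n => interleave b b' n - interleave a a' n)
            = interleave (fun n => b n - a n) (fun n => b' n - a' n)).
  { apply functional_extensionality; intros n.
    unfold interleave; destruct (Nat.even n); reflexivity. }
  exists (interleave a a'), (interleave b b'); repeat split.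
  - intros n; unfold interleave; destruct (Nat.even n); auto.
  - intros x [Hx|Hx].
    + destruct (A2 x Hx) as [n Hn]; exists (2 * n)%nat.
      now rewrite !interleave_even.
    + destruct (B2 x Hx) as [n Hn]; exists (S (2 * n)).
      now rewrite !interleave_odd.
  - intros N; rewrite Hdiff.
    apply Rle_trans with (sum_f_R0
      (interleave (fun n => b n - a n) (fun n => b' n - a' n)) (S (2 * N))).
    + apply sum_nonneg_mono; [|lia].
      apply interleave_elim; intros n;
        [specialize (A1 n)|specialize (B1 n)]; lra.
    + rewrite sum_interleave; specialize (A3 N); specialize (B3 N); lra.
Qed.

Lemma outer_le_open_interval (u v : R) :
  u <= v -> outer_le (fun x => u < x /\ x < v) (v - u).
Proof.
  intros Huv d Hd.
  (* One interval covers the set; the rest of the sequence is padded with empty intervals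
     [(u, u)]. *)
  exists (fun _ => u), (fun n => match n with O => v | S _ => u end).
  repeat split.
  - intros [|n]; lra.
  - intros x Hx; exists 0%nat; exact Hx.
  - intros N; apply Rle_trans with (v - u); [|lra].
    induction N as [|N IH]; simpl; lra.
Qed.

Lemma outer_le_Ico (s t : R) : s <= t -> outer_le (Ico s t) (t - s).
Proof.
  intros Hst d Hd.
  (* An open interval of the same length misses [s]; widening by [d / 4] on both sides costs
     [d / 2], leaving part of the slack [d] for the cover itself. *)
  pose proof (outer_le_open_interval (s - d / 4) (t + d / 4) ltac:(lra)) as H.
  assert (H' : outer_le (Ico s t) (t + d / 4 - (s - d / 4))).
  { eapply outer_le_mono; [|apply Rle_refl|exact H].
    intros x [H1 H2]; lra. }
  destruct (H' (d / 4) ltac:(lra)) as (a & b & H1 & H2 & H3).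
  exists a, b; repeat split; auto.
  intros N; specialize (H3 N); lra.
Qed.

Lemma outer_le_closed (A : Rset) (r : R) :
  (forall d, 0 < d -> outer_le A (r + d)) -> outer_le A r.
Proof.
  intros H d Hd.
  destruct (H (d / 2) ltac:(lra) (d / 2) ltac:(lra)) as (a & b & H1 & H2 & H3).
  exists a, b; repeat split; auto.
  intros N; specialize (H3 N); lra.
Qed.

(** [completeness] yields suprema, so it is applied to the negated bounds. The infimum is itself a
    bound because [outer_le] tolerates every positive slack. *)
Lemma outer_eq_exists (A : Rset) (r : R) : outer_le A r -> exists q, outer_eq A q.
Proof.
  intros Hr.
  destruct (completeness (fun y => outer_le A (- y))) as [l [Hub Hl]].
  - exists 0; intros y Hy; apply outer_le_nonneg in Hy; lra.
  - exists (- r); now rewrite Ropp_involutive.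
  - exists (- l); split.
    + apply outer_le_closed; intros d Hd.
      apply NNPP; intros Hn.
      assert (l <= l - d); [|lra].
      apply Hl; intros y Hy.
      apply Rnot_lt_le; intros Hlt; apply Hn.
      apply outer_le_mono with A (- y); [intros x; auto|lra|exact Hy].
    + intros q Hq; specialize (Hub (- q)); cbv beta in Hub.
      rewrite Ropp_involutive in Hub; specialize (Hub Hq); lra.
Qed.

Lemma outer_eq_unique (A : Rset) (r s : R) :
  outer_eq A r -> outer_eq A s -> r = s.
Proof. intros [H1 H2] [H3 H4]; apply Rle_antisym; auto. Qed.

(* Meaningful only for sets of finite outer measure. *)
Definition mu (A : Rset) : R := epsilon (inhabits 0) (outer_eq A).

Lemma mu_outer_eq (A : Rset) (r : R) : outer_le A r -> outer_eq A (mu A).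
Proof. intros H; apply (epsilon_spec _ (outer_eq A)), (outer_eq_exists A r H). Qed.

Lemma mu_unique (A : Rset) (r : R) : outer_eq A r -> mu A = r.
Proof.
  intros H; apply outer_eq_unique with A; [|exact H].
  apply mu_outer_eq with r, H.
Qed.

(** * Measurable sets *)

(** The outer measures of the two pieces, being least bounds, serve as [r1] and [r2] for every [d]
    at once, so the error [d] can tend to zero. *)
Lemma measurable_intro (A : Rset) :
  (forall E r d, outer_le E r -> 0 < d -> exists r1 r2, r1 + r2 <= r + d /\
     outer_le (setI E A) r1 /\ outer_le (setD E A) r2) ->
  lebesgue_measurable A.
Proof.
  intros H E r HE.
  assert (HI : outer_eq (setI E A) (mu (setI E A))).
  { apply mu_outer_eq with r, outer_le_mono with E r;
      [intros x []; auto|lra|exact HE]. }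
  assert (HD : outer_eq (setD E A) (mu (setD E A))).
  { apply mu_outer_eq with r, outer_le_mono with E r;
      [intros x []; auto|lra|exact HE]. }
  exists (mu (setI E A)), (mu (setD E A)); split; [|split; [apply HI|apply HD]].
  apply Rle_plus_epsilon; intros d Hd.
  destruct (H E r d HE Hd) as (r1 & r2 & H1 & H2 & H3).
  apply HI in H2; apply HD in H3; lra.
Qed.

Lemma measurable_compl (A : Rset) :
  lebesgue_measurable A -> lebesgue_measurable (fun x => ~ A x).
Proof.
  intros H E r HE; destruct (H E r HE) as (r1 & r2 & H1 & H2 & H3).
  exists r2, r1; split; [lra|split; [exact H3|]].
  apply outer_le_mono with (setI E A) r1; [|lra|exact H2].
  intros x [Hx Hn]; split; [exact Hx|apply NNPP, Hn].
Qed.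

(** The test set is cut by [A], then its part inside [A] by [B]; the two leftover pieces together
    cover what lies outside the intersection. *)
Lemma measurable_setI (A B : Rset) :
  lebesgue_measurable A -> lebesgue_measurable B ->
  lebesgue_measurable (setI A B).
Proof.
  intros HA HB E r HE.
  destruct (HA E r HE) as (r1 & r2 & H1 & H2 & H3).
  destruct (HB _ r1 H2) as (s1 & s2 & G1 & G2 & G3).
  exists s1, (s2 + r2); split; [lra|split].
  - eapply outer_le_mono; [|apply Rle_refl|exact G2].
    intros x (H & H' & H''); tauto.
  - eapply outer_le_mono; [|apply Rle_refl|
      apply (outer_le_union _ _ _ _ G3 H3)].
    intros x [H H']; unfold setI, setU in *.
    destruct (classic (A x)); tauto.
Qed.

Lemma measurable_setD (A B : Rset) :
  lebesgue_measurable A -> lebesgue_measurable B ->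
  lebesgue_measurable (setD A B).
Proof. intros HA HB; apply measurable_setI; auto using measurable_compl. Qed.

Lemma measurable_setU (A B : Rset) :
  lebesgue_measurable A -> lebesgue_measurable B ->
  lebesgue_measurable (setU A B).
Proof.
  intros HA HB.
  replace (setU A B) with (fun x => ~ setI (fun x => ~ A x) (fun x => ~ B x) x).
  - apply measurable_compl, measurable_setI; auto using measurable_compl.
  - set_eq; destruct (classic (A x)), (classic (B x)); tauto.
Qed.

Lemma measurable_set0 : lebesgue_measurable (fun _ => False).
Proof.
  apply measurable_intro; intros E r d HE Hd.
  exists 0, r; split; [lra|split].
  - replace 0 with (0 - 0) by lra.
    eapply outer_le_mono; [|apply Rle_refl|apply outer_le_Ico, Rle_refl].
    intros x [_ []].
  - eapply outer_le_mono; [|apply Rle_refl|exact HE]; intros x []; auto.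
Qed.

(** With [s1] the supremum of [f], the remainder [s - s1] bounds [g] because the two indices vary
    independently. This separates the costs of the two halves of a cut cover. *)
Lemma split_bound (f g : nat -> R) (s : R) :
  (forall N M, f N + g M <= s) ->
  exists s1 s2, s1 + s2 <= s /\ (forall N, f N <= s1) /\ (forall N, g N <= s2).
Proof.
  intros H.
  destruct (completeness (fun y => exists N, y = f N)) as [l [Hub Hl]].
  - exists (s - g 0%nat); intros y [N ->]; specialize (H N 0%nat); lra.
  - exists (f 0%nat), 0%nat; reflexivity.
  - exists l, (s - l); split; [lra|split].
    + intros N; apply Hub; eauto.
    + intros M; assert (l <= s - g M); [|lra].
      apply Hl; intros y [N ->]; specialize (H N M); lra.
Qed.

Lemma measurable_Iio (t : R) : lebesgue_measurable (Iio t).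
Proof.
  apply measurable_intro; intros E r d HE Hd.
  destruct (HE (d / 2) ltac:(lra)) as (a & b & H1 & H2 & H3).
  (* [f n] and [g n] are the lengths of the parts of the [n]-th interval below and above [t]. *)
  pose (f := fun n => Rmin (b n) t - Rmin (a n) t).
  pose (g := fun n => Rmax (b n) t - Rmax (a n) t).
  assert (Hfg : forall n, 0 <= f n /\ 0 <= g n /\ f n + g n = b n - a n).
  { intros n; specialize (H1 n); unfold f, g, Rmin, Rmax.
    repeat destruct (Rle_dec _ _); lra. }
  destruct (split_bound (sum_f_R0 f) (sum_f_R0 g) (r + d / 2))
    as (s1 & s2 & Hs & Hs1 & Hs2).
  { intros N M; apply Rle_trans with (sum_f_R0 (fun n => b n - a n) (max N M));
      [|apply H3].
    apply Rle_trans with (sum_f_R0 f (max N M) + sum_f_R0 g (max N M)).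
    - apply Rplus_le_compat; apply sum_nonneg_mono; try lia; apply Hfg.
    - rewrite <- plus_sum; apply Req_le, sum_eq; intros; apply Hfg. }
  exists s1, (s2 + d / 2); split; [lra|split].
  - intros e He; exists (fun n => Rmin (a n) t), (fun n => Rmin (b n) t).
    repeat split.
    + intros n; specialize (Hfg n); unfold f in Hfg; lra.
    + intros x [Hx Hxt]; destruct (H2 x Hx) as [n Hn]; exists n.
      unfold Iio in Hxt; unfold Rmin; repeat destruct (Rle_dec _ _); lra.
    + intros N; specialize (Hs1 N); unfold f in Hs1; lra.
  - assert (Hgt : outer_le (fun x => E x /\ t < x) s2).
    { intros e He; exists (fun n => Rmax (a n) t), (fun n => Rmax (b n) t).
      repeat split.
      + intros n; specialize (Hfg n); unfold g in Hfg; lra.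
      + intros x [Hx Hxt]; destruct (H2 x Hx) as [n Hn]; exists n.
        unfold Rmax; repeat destruct (Rle_dec _ _); lra.
      + intros N; specialize (Hs2 N); unfold g in Hs2; lra. }
    (* The cut open intervals may miss the point [t] itself; [[t, t + d / 2)] covers it at the price
       [d / 2]. *)
    pose proof (outer_le_union _ _ _ _ Hgt
      (outer_le_Ico t (t + d / 2) ltac:(lra))) as H.
    eapply outer_le_mono; [|apply Req_le|exact H]; [|lra].
    intros x [Hx Hxt]; unfold setU, Ico, Iio in *.
    destruct (Req_dec x t); [right; lra|left; split; [exact Hx|lra]].
Qed.

Lemma measurable_Ico (s t : R) : lebesgue_measurable (Ico s t).
Proof.
  replace (Ico s t) with (setD (Iio t) (Iio s)).
  - apply measurable_setD; apply measurable_Iio.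
  - set_eq; lra.
Qed.

(** * A finitely additive, atomless measure on bounded sets *)

(** Boundedness makes the outer measure finite, so that [mu] is meaningful. *)
Definition bmeas (A : Rset) : Prop :=
  lebesgue_measurable A /\ exists s t, s <= t /\ subset A (Ico s t).

Lemma bmeas_subset (A B : Rset) :
  bmeas B -> lebesgue_measurable A -> subset A B -> bmeas A.
Proof.
  intros [_ (s & t & Hst & H)] HA HAB; split; [exact HA|].
  exists s, t; split; [exact Hst|]; intros x Hx; apply H, HAB, Hx.
Qed.

Lemma bmeas_setI (A B : Rset) :
  bmeas A -> lebesgue_measurable B -> bmeas (setI A B).
Proof.
  intros HA HB; apply bmeas_subset with A; [exact HA| |intros x []; auto].
  apply measurable_setI; [apply HA|exact HB].
Qed.

Lemma bmeas_setD (A B : Rset) :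
  bmeas A -> lebesgue_measurable B -> bmeas (setD A B).
Proof. intros HA HB; apply bmeas_setI; auto using measurable_compl. Qed.

Lemma bmeas_setU (A B : Rset) : bmeas A -> bmeas B -> bmeas (setU A B).
Proof.
  intros [HA (s & t & Hst & H)] [HB (s' & t' & Hst' & H')]; split;
    [apply measurable_setU; auto|].
  exists (Rmin s s'), (Rmax t t'); split.
  - generalize (Rmin_l s s') (Rmax_l t t'); lra.
  - generalize (Rmin_l s s') (Rmax_l t t') (Rmin_r s s') (Rmax_r t t').
    intros ? ? ? ? x [Hx|Hx]; [apply H in Hx|apply H' in Hx];
      unfold Ico in *; lra.
Qed.

Lemma bmeas_Ico (s t : R) : s <= t -> bmeas (Ico s t).
Proof.
  intros Hst; split; [apply measurable_Ico|].
  exists s, t; split; [exact Hst|intros x; auto].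
Qed.

Lemma bmeas_set0 : bmeas (fun _ => False).
Proof. split; [exact measurable_set0|]; exists 0, 0; split; [lra|intros x []]. Qed.

#[local] Hint Resolve bmeas_setI bmeas_setD bmeas_setU bmeas_set0 : bm.

Lemma bmeas_outer_eq (A : Rset) : bmeas A -> outer_eq A (mu A).
Proof.
  intros [_ (s & t & Hst & H)]; apply mu_outer_eq with (t - s).
  eapply outer_le_mono; [exact H|apply Rle_refl|now apply outer_le_Ico].
Qed.

Lemma mu_nonneg (A : Rset) : bmeas A -> 0 <= mu A.
Proof.
  intros HA; destruct (bmeas_outer_eq A HA) as [H _].
  eapply outer_le_nonneg; eauto.
Qed.

Lemma mu_mono (A B : Rset) : bmeas A -> bmeas B -> subset A B -> mu A <= mu B.
Proof.
  intros HA HB H; apply (bmeas_outer_eq A HA).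
  eapply outer_le_mono; [exact H|apply Rle_refl|apply (bmeas_outer_eq B HB)].
Qed.

(** One inequality is subadditivity, the other is Caratheodory's condition for [B] with [A] as the
    test set. *)
Lemma mu_split (A B : Rset) :
  bmeas A -> lebesgue_measurable B -> mu A = mu (setI A B) + mu (setD A B).
Proof.
  intros HA HB.
  pose proof (bmeas_outer_eq _ HA) as [H1 H2].
  pose proof (bmeas_outer_eq _ (bmeas_setI A B HA HB)) as [H3 H4].
  pose proof (bmeas_outer_eq _ (bmeas_setD A B HA HB)) as [H5 H6].
  apply Rle_antisym.
  - apply H2; eapply outer_le_mono; [|apply Rle_refl|
      apply (outer_le_union _ _ _ _ H3 H5)].
    intros x Hx; unfold setU, setI, setD; destruct (classic (B x)); tauto.
  - destruct (HB A _ H1) as (r1 & r2 & G1 & G2 & G3).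
    apply H4 in G2; apply H6 in G3; lra.
Qed.

Lemma mu_disjoint_union (A B : Rset) :
  bmeas A -> bmeas B -> disjoint A B -> mu (setU A B) = mu A + mu B.
Proof.
  intros HA HB H; rewrite (mu_split (setU A B) A); [|auto with bm|apply HA].
  replace (setI (setU A B) A) with A by set_eq.
  replace (setD (setU A B) A) with B; [reflexivity|].
  set_eq; specialize (H x); tauto.
Qed.

Lemma mu_setD_subset (A B : Rset) :
  bmeas A -> bmeas B -> subset B A -> mu (setD A B) = mu A - mu B.
Proof.
  intros HA HB H; rewrite (mu_split A B HA (proj1 HB)).
  replace (setI A B) with B; [lra|].
  set_eq; specialize (H x); tauto.
Qed.

Lemma mu_Ico_le (s t : R) : s <= t -> mu (Ico s t) <= t - s.
Proof. intros H; apply bmeas_outer_eq; auto using bmeas_Ico, outer_le_Ico. Qed.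

Lemma mu_set0 : mu (fun _ => False) = 0.
Proof.
  apply Rle_antisym; [|apply mu_nonneg, bmeas_set0].
  apply Rle_trans with (mu (Ico 0 0)).
  - apply mu_mono; [apply bmeas_set0|apply bmeas_Ico; lra|intros x []].
  - generalize (mu_Ico_le 0 0); lra.
Qed.

(* Real induction on [t]: the length of the part of the cover lying in [[s, t)]
   is [sum (min b t - min a t) - sum (min b s - min a s)], and the interval
   containing the supremum of the good [t] pushes past it. *)
Lemma cover_length (a b : nat -> R) (s T : R) :
  s <= T -> (forall n, a n <= b n) ->
  (forall x, Ico s T x -> exists n, a n < x /\ x < b n) ->
  forall T', s <= T' -> T' < T ->
  exists N, T' - s <= sum_f_R0 (fun n => b n - a n) N.
Proof.
  intros HsT Hab Hcov T' HsT' HT'.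
  pose (h := fun t n => (Rmin (b n) t - Rmin (a n) t)
                        - (Rmin (b n) s - Rmin (a n) s)).
  assert (Hh0 : forall t n, s <= t -> 0 <= h t n).
  { intros t n Ht; specialize (Hab n); unfold h, Rmin.
    repeat destruct (Rle_dec _ _); lra. }
  assert (Hhmono : forall t t' n, t <= t' -> h t n <= h t' n).
  { intros t t' n Ht; specialize (Hab n); unfold h, Rmin.
    repeat destruct (Rle_dec _ _); lra. }
  assert (Hhmax : forall t n, s <= t -> h t n <= b n - a n).
  { intros t n Ht; specialize (Hab n); unfold h, Rmin.
    repeat destruct (Rle_dec _ _); lra. }
  pose (good := fun t => s <= t <= T' /\ exists N, t - s <= sum_f_R0 (h t) N).
  assert (Hs : good s).
  { split; [lra|]; exists 0%nat; simpl; specialize (Hh0 s 0%nat); lra. }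
  destruct (completeness good) as [l [Hub Hl]].
  { exists T'; intros t [Ht _]; lra. }
  { exists s; exact Hs. }
  assert (Hsl : s <= l) by (apply Hub, Hs).
  assert (HlT : l <= T') by (apply Hl; intros t [Ht _]; lra).
  destruct (Hcov l) as (n & Hn1 & Hn2); [split; lra|].
  assert (Ht : exists t, good t /\ a n < t).
  { apply NNPP; intros Hno; assert (l <= a n); [|lra].
    apply Hl; intros t Ht; apply Rnot_lt_le; intros Hlt; eauto. }
  destruct Ht as (t & Hgt & Hant).
  assert (Htl : t <= l) by (apply Hub, Hgt).
  destruct Hgt as ([Hst HtT] & N & HN).
  pose (t' := Rmin T' ((l + b n) / 2)).
  assert (Ht' : l <= t' /\ t' < b n /\ t' <= T' /\ (t' = T' \/ l < t')).
  { unfold t', Rmin; destruct (Rle_dec _ _); lra. }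
  assert (Hgt' : good t').
  { split; [lra|]; exists (max N n).
    apply Rle_trans with (sum_f_R0 (h t) (max N n) + (t' - t)).
    - assert (sum_f_R0 (h t) N <= sum_f_R0 (h t) (max N n)); [|lra].
      apply sum_nonneg_mono; [intros; apply Hh0; lra|lia].
    (* The [n]-th interval contains [[t, t']], so its own term grows by the full [t' - t], and no
       other term decreases. *)
    - assert (Hinc : forall j, (n <= j)%nat ->
        sum_f_R0 (h t) j + (t' - t) <= sum_f_R0 (h t') j).
      { assert (Hn : h t n + (t' - t) <= h t' n).
        { unfold h, Rmin; repeat destruct (Rle_dec _ _); lra. }
        induction 1 as [|j _ IH].
        - destruct n as [|n0]; [exact Hn|].
          rewrite !tech5.
          assert (sum_f_R0 (h t) n0 <= sum_f_R0 (h t') n0); [|lra].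
          apply sum_Rle; intros; apply Hhmono; lra.
        - rewrite !tech5; specialize (Hhmono t t' (S j)); lra. }
      apply Hinc; lia. }
  (* As [l] is an upper bound, [l < t'] is impossible, so the cap [T'] has been reached. *)
  pose proof (Hub _ Hgt').
  assert (HT : t' = T') by lra.
  destruct Hgt' as (_ & N' & HN').
  exists N'; rewrite <- HT; eapply Rle_trans; [exact HN'|].
  apply sum_Rle; intros; apply Hhmax; lra.
Qed.

Lemma mu_Ico (s t : R) : s <= t -> mu (Ico s t) = t - s.
Proof.
  intros Hst; apply Rle_antisym; [now apply mu_Ico_le|].
  destruct (bmeas_outer_eq _ (bmeas_Ico s t Hst)) as [H _].
  destruct (Rle_lt_or_eq_dec _ _ Hst) as [Hlt|Heq];
    [|generalize (mu_nonneg _ (bmeas_Ico s t Hst)); lra].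
  apply Rle_plus_epsilon; intros d Hd.
  destruct (H (d / 2) ltac:(lra)) as (a & b & H1 & H2 & H3).
  (* [cover_length] works strictly below [t]; stopping at [T'] loses at most [d / 2], the other half
     of [d] being the slack of the cover. *)
  pose (T' := Rmax s (t - d / 2)).
  destruct (cover_length a b s t Hst H1 H2 T') as [N HN].
  - apply Rmax_l.
  - unfold T', Rmax; destruct (Rle_dec _ _); lra.
  - specialize (H3 N); generalize (Rmax_r s (t - d / 2)); fold T'; lra.
Qed.

(** The measure of the part of [B] below [u] is a 1-Lipschitz function of [u] running from 0 to
    [mu B], so the intermediate value theorem applies. *)
Lemma subset_of_measure (B : Rset) (r : R) :
  bmeas B -> 0 <= r <= mu B -> exists Y, bmeas Y /\ subset Y B /\ mu Y = r.
Proof.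
  intros HB Hr; destruct HB as [HBm (s & t & Hst & HBsub)].
  assert (HB : bmeas B) by (split; eauto).
  pose (g := fun u => mu (setI B (Iio u))).
  assert (Hb : forall u, bmeas (setI B (Iio u)))
    by (intros; apply bmeas_setI; auto using measurable_Iio).
  assert (Hlip : forall u v, u <= v -> 0 <= g v - g u <= v - u).
  { intros u v Huv; unfold g.
    rewrite (mu_split (setI B (Iio v)) (Iio u)) by auto using measurable_Iio.
    replace (setI (setI B (Iio v)) (Iio u)) with (setI B (Iio u))
      by (set_eq; intuition lra).
    set (D := setD _ _).
    assert (HD : bmeas D) by (apply bmeas_setD; auto using measurable_Iio).
    pose proof (mu_nonneg D HD).
    assert (mu D <= mu (Ico u v)).
    { apply mu_mono; [exact HD|now apply bmeas_Ico|].
      unfold D, setD, setI, Iio, Ico; intros x Hx; lra. }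
    pose proof (mu_Ico_le u v Huv); lra. }
  assert (Hcont : continuity (fun u => g u - r)).
  { intros u e He; exists e; split; [exact He|].
    intros v [_ Hv]; simpl in *; unfold Rdist in *.
    destruct (Rle_lt_dec u v) as [Huv|Huv].
    - generalize (Hlip u v Huv); intros.
      rewrite Rabs_right in Hv by lra; rewrite Rabs_right; lra.
    - generalize (Hlip v u ltac:(lra)); intros.
      rewrite Rabs_left in Hv by lra; rewrite Rabs_left1; lra. }
  assert (Hs : g s = 0).
  { unfold g; rewrite <- mu_set0; f_equal; set_eq.
    specialize (HBsub x); unfold Ico in HBsub; split; [|tauto].
    intros [Hx ?]; specialize (HBsub Hx); lra. }
  assert (Ht : g t = mu B).
  { unfold g; f_equal; set_eq; split; [tauto|intros Hx; split; auto].
    apply HBsub, Hx. }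
  destruct (IVT_cor _ s t Hcont Hst) as (u & Hu & Hgu).
  { cbv beta; rewrite Hs, Ht; nra. }
  exists (setI B (Iio u)); repeat split; auto.
  - apply (Hb u).
  - exists s, t; split; auto; intros x []; auto.
  - intros x []; auto.
  - fold (g u); lra.
Qed.

(** * Independent copies of a family of sets *)

Lemma mu_setI_union (A B P : Rset) :
  bmeas A -> bmeas B -> lebesgue_measurable P -> disjoint A B ->
  mu (setI (setU A B) P) = mu (setI A P) + mu (setI B P).
Proof.
  intros HA HB HP H; rewrite <- mu_disjoint_union; auto with bm.
  - f_equal; set_eq.
  - intros x [[] []]; apply (H x); auto.
Qed.

Lemma setD_union (A B : Rset) : subset B A -> setU B (setD A B) = A.
Proof.
  intros H; set_eq; specialize (H x); destruct (classic (B x)); tauto.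
Qed.

Lemma disjoint_setD (A B : Rset) : disjoint B (setD A B).
Proof. intros x [H [_ H']]; auto. Qed.

Lemma disjoint_subset (A B A' B' : Rset) :
  subset A' A -> subset B' B -> disjoint A B -> disjoint A' B'.
Proof. intros HA HB H x [H1 H2]; apply (H x); auto. Qed.

(** A sample of density [th] is taken separately inside and outside the first set of the list,
    recursively, so the union has that density in every set of the list. The base case is the
    absence of atoms. *)
Lemma uniform_subset (Ps : list Rset) (X : Rset) (th : R) :
  (forall P, In P Ps -> lebesgue_measurable P) -> bmeas X -> 0 <= th <= 1 ->
  exists Y, bmeas Y /\ subset Y X /\ mu Y = th * mu X /\
    forall P, In P Ps -> mu (setI Y P) = th * mu (setI X P).
Proof.
  intros HPs HX Hth; revert X HX; induction Ps as [|P Ps IH]; intros X HX.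
  - destruct (subset_of_measure X (th * mu X) HX) as (Y & H1 & H2 & H3).
    { pose proof (mu_nonneg X HX); nra. }
    exists Y; repeat split; try apply H1; auto; intros P [].
  - assert (HP : lebesgue_measurable P) by (apply HPs; left; reflexivity).
    assert (HPs' : forall Q, In Q Ps -> lebesgue_measurable Q)
      by (intros; apply HPs; right; assumption).
    destruct (IH HPs' (setI X P)) as (Y & HY & HYX & HYm & HYP); auto with bm.
    destruct (IH HPs' (setD X P)) as (Z & HZ & HZX & HZm & HZP); auto with bm.
    assert (Hd : disjoint Y Z).
    { intros x [Hy Hz]; apply HYX in Hy; apply HZX in Hz.
      destruct Hy, Hz; auto. }
    assert (HX' : setU (setI X P) (setD X P) = X).
    { set_eq; destruct (classic (P x)); tauto. }
    exists (setU Y Z); split; [auto with bm|split; [|split]].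
    + intros x [Hx|Hx]; [apply HYX in Hx|apply HZX in Hx]; apply Hx.
    + rewrite mu_disjoint_union, HYm, HZm by auto.
      rewrite (mu_split X P) by auto; ring.
    + intros Q [<-|HQ].
      * replace (setI (setU Y Z) P) with Y; [exact HYm|].
        set_eq; specialize (HYX x); specialize (HZX x).
        unfold setI, setD in *; tauto.
      * rewrite mu_setI_union, HYP, HZP by auto.
        rewrite <- HX' at 3.
        rewrite (mu_setI_union (setI X P) (setD X P) Q); auto with bm.
        -- ring.
        -- intros x [[] []]; auto.
Qed.

(** [g P] is the prescribed relative density of [P] in [X]; a density independent of [X] expresses
    statistical independence. *)
Definition uniform (Ps : list Rset) (g : Rset -> R) (X : Rset) : Prop :=
  forall P, In P Ps -> mu (setI X P) = g P * mu X.

Lemma uniform_setU (Ps : list Rset) (g : Rset -> R) (A B : Rset) :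
  (forall P, In P Ps -> lebesgue_measurable P) ->
  bmeas A -> bmeas B -> disjoint A B ->
  uniform Ps g A -> uniform Ps g B -> uniform Ps g (setU A B).
Proof.
  intros HPs HA HB Hd HgA HgB P HP.
  rewrite mu_setI_union, mu_disjoint_union, HgA, HgB by auto; ring.
Qed.

Lemma uniform_null (Ps : list Rset) (g : Rset -> R) (A : Rset) :
  (forall P, In P Ps -> lebesgue_measurable P) ->
  bmeas A -> mu A = 0 -> uniform Ps g A.
Proof.
  intros HPs HA H P HP; rewrite H, Rmult_0_r.
  apply Rle_antisym; [rewrite <- H|]; [apply mu_mono|apply mu_nonneg];
    auto with bm; intros x []; auto.
Qed.

Definition pull (X : Rset) (f : R -> R) (c : Rset) : Rset :=
  fun x => X x /\ c (f x).

(* [f] is constant on each cell of a finite partition of [X']; since the copy of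
   a set is its preimage, all Boolean relations between sets are preserved.
   [X'] may drop a null part of [X], when an atom of [cs] in [Z] is empty. *)
Lemma transport (Ps : list Rset) (g : Rset -> R) (cs : list Rset) (Z X : Rset) :
  (forall P, In P Ps -> lebesgue_measurable P) ->
  (forall c, In c cs -> lebesgue_measurable c) ->
  bmeas Z -> bmeas X -> mu X = mu Z -> uniform Ps g X ->
  exists f X', subset X' X /\ bmeas X' /\ mu X' = mu Z /\
    uniform Ps g X' /\ (forall x, X' x -> Z (f x)) /\
    forall c, In c cs -> bmeas (pull X' f c) /\
      mu (pull X' f c) = mu (setI Z c) /\ uniform Ps g (pull X' f c).
Proof.
  intros HPs; revert Z X; induction cs as [|c cs IH]; intros Z X Hcs HZ HX Hm Hu.
  (* With no sets left to distinguish, one point represents all of [Z]. If [Z] is empty there is no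
     such point, and the null set [X] is replaced by the empty set. *)
  - destruct (classic (exists z, Z z)) as [[z Hz]|Hz].
    + exists (fun _ => z), X; repeat split; try apply HX; auto;
        try (intros x Hx; exact Hx); contradiction.
    + assert (HZ0 : Z = fun _ => False) by (set_eq; firstorder).
      exists (fun x => x), (fun _ => False).
      rewrite HZ0, mu_set0; repeat split; try apply bmeas_set0; auto;
        try contradiction.
      * intros x [].
      * apply uniform_null; auto using bmeas_set0, mu_set0.
  - assert (Hc : lebesgue_measurable c) by (apply Hcs; left; reflexivity).
    assert (Hcs' : forall d, In d cs -> lebesgue_measurable d)
      by (intros; apply Hcs; right; assumption).
    assert (HZ1 : bmeas (setI Z c)) by auto with bm.
    assert (HZ2 : bmeas (setD Z c)) by auto with bm.
    pose proof (mu_split Z c HZ Hc) as HZs.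
    pose proof (mu_nonneg _ HZ1) as HZ1n.
    pose proof (mu_nonneg _ HZ2) as HZ2n.
    (* [th] is the proportion of [Z] lying in [c]; for null [Z] any proportion works, and 0 is
       taken. *)
    assert (Hth : exists th, 0 <= th <= 1 /\ th * mu Z = mu (setI Z c)).
    { destruct (Req_dec (mu Z) 0) as [H0|H0].
      - exists 0; lra.
      - exists (mu (setI Z c) / mu Z); repeat split.
        + apply Rle_mult_inv_pos; lra.
        + apply Rmult_le_reg_r with (mu Z); [lra|].
          unfold Rdiv; rewrite Rmult_assoc, Rinv_l by exact H0; lra.
        + now field. }
    destruct Hth as (th & Hth & HthZ).
    destruct (uniform_subset Ps X th HPs HX Hth) as (Y & HY & HYX & HYm & HYP).
    pose proof (mu_setD_subset X Y HX HY HYX) as HXY.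
    destruct (IH (setI Z c) Y) as (f & Y' & F1 & F2 & F3 & F4 & F5 & F6);
      auto; try congruence.
    { intros P HP; rewrite HYP, HYm, Hu by auto; ring. }
    destruct (IH (setD Z c) (setD X Y))
      as (h & W' & G1 & G2 & G3 & G4 & G5 & G6); auto.
    { apply bmeas_setD; [exact HX|apply HY]. }
    { rewrite HXY, HYm, Hm, HthZ; lra. }
    { intros P HP.
      pose proof (mu_setI_union Y (setD X Y) P HY
        (bmeas_setD X Y HX (proj1 HY)) (HPs P HP) (disjoint_setD X Y)) as H.
      rewrite setD_union, HYP, Hu in H by auto.
      rewrite HXY, HYm; lra. }
    assert (Hd : disjoint Y' W').
    { apply (disjoint_subset Y (setD X Y)); auto using disjoint_setD. }
    pose (q := fun x => if excluded_middle_informative (Y' x)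
                        then f x else h x).
    assert (Hq : forall d, pull (setU Y' W') q d
                           = setU (pull Y' f d) (pull W' h d)).
    { intros d; set_eq; unfold pull, setU, q; specialize (Hd x).
      destruct (excluded_middle_informative (Y' x)); tauto. }
    exists q, (setU Y' W').
    split; [|split; [auto with bm|split; [|split; [|split]]]].
    + intros x [Hx|Hx]; [apply HYX, F1, Hx|apply G1 in Hx; apply Hx].
    + rewrite mu_disjoint_union, F3, G3 by auto; lra.
    + apply uniform_setU; auto.
    + intros x Hx; unfold q.
      destruct (excluded_middle_informative (Y' x)) as [Hy|Hy].
      * apply F5, Hy.
      * destruct Hx as [Hx|Hx]; [contradiction|apply G5, Hx].
    + intros d Hd'; rewrite Hq.
      assert (Hpd : disjoint (pull Y' f d) (pull W' h d)).
      { apply (disjoint_subset Y' W'); auto; intros x []; auto. }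
      destruct Hd' as [<-|Hd'].
      * replace (pull Y' f c) with Y'.
        2:{ set_eq; unfold pull; specialize (F5 x); unfold setI in F5; tauto. }
        replace (pull W' h c) with (fun _ : R => False).
        2:{ set_eq; unfold pull; specialize (G5 x); unfold setD in G5; tauto. }
        replace (setU Y' (fun _ => False)) with Y' by set_eq; auto.
      * destruct (F6 d Hd') as (A1 & A2 & A3).
        destruct (G6 d Hd') as (B1 & B2 & B3).
        split; [auto with bm|split; [|apply uniform_setU; auto]].
        rewrite mu_disjoint_union, A2, B2 by auto.
        rewrite (mu_split (setI Z d) c) by auto with bm.
        f_equal; f_equal; set_eq.
Qed.

Lemma copy_into (cs : list Rset) (Z X : Rset) :
  (forall c, In c cs -> lebesgue_measurable c) ->
  bmeas Z -> bmeas X -> mu X = mu Z ->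
  exists f X', subset X' X /\ forall c, In c cs ->
    bmeas (pull X' f c) /\ mu (pull X' f c) = mu (setI Z c).
Proof.
  intros Hcs HZ HX Hm.
  destruct (transport nil (fun _ => 0) cs Z X)
    as (f & X' & H1 & _ & _ & _ & _ & H2); auto; try (intros P []).
  exists f, X'; split; [exact H1|].
  intros c Hc; destruct (H2 c Hc) as (H3 & H4 & _); auto.
Qed.

(** * Extending the precoloring *)

Lemma unit_set_bmeas (m : R) (A : Rset) :
  0 <= m -> unit_set m A -> bmeas A /\ mu A = 1 /\ subset A (Ico 0 m).
Proof.
  intros Hm (H1 & H2 & H3); repeat split; try (apply H1; assumption).
  - exact H2.
  - exists 0, m; split; [exact Hm|exact H1].
  - apply mu_unique, H3.
Qed.

Lemma bmeas_unit_set (m : R) (A : Rset) :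
  bmeas A -> mu A = 1 -> subset A (Ico 0 m) -> unit_set m A.
Proof.
  intros H1 H2 H3; split; [exact H3|split; [apply H1|]].
  rewrite <- H2; now apply bmeas_outer_eq.
Qed.

Lemma edge_colorable_ge2 (G : graph) (k : R) (c : vtx G -> Rset) (u v : vtx G) :
  0 <= k -> frac_coloring G k c -> adj G u v -> 2 <= k.
Proof.
  intros Hk [Hc Hd] Huv.
  destruct (unit_set_bmeas k _ Hk (Hc u)) as (U1 & U2 & U3).
  destruct (unit_set_bmeas k _ Hk (Hc v)) as (V1 & V2 & V3).
  assert (H : mu (setU (c u) (c v)) <= mu (Ico 0 k)).
  { apply mu_mono; auto using bmeas_Ico with bm; intros x []; auto. }
  rewrite mu_disjoint_union, mu_Ico in H; auto; [lra|exact (Hd u v Huv)].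
Qed.

Lemma triangle_colorable_ge3 (G : graph) (k : R) (c : vtx G -> Rset)
    (u v w : vtx G) :
  0 <= k -> frac_coloring G k c -> adj G u v -> adj G u w -> adj G v w ->
  3 <= k.
Proof.
  intros Hk [Hc Hd] Huv Huw Hvw.
  destruct (unit_set_bmeas k _ Hk (Hc u)) as (U1 & U2 & U3).
  destruct (unit_set_bmeas k _ Hk (Hc v)) as (V1 & V2 & V3).
  destruct (unit_set_bmeas k _ Hk (Hc w)) as (W1 & W2 & W3).
  assert (H : mu (setU (setU (c u) (c v)) (c w)) <= mu (Ico 0 k)).
  { apply mu_mono; auto using bmeas_Ico with bm; intros x [[]|]; auto. }
  rewrite !mu_disjoint_union, mu_Ico in H; auto with bm; [lra| |].
  - exact (Hd u v Huv).
  - intros x [[Hx|Hx] Hx']; [apply (Hd u w Huw x)|apply (Hd v w Hvw x)]; auto.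
Qed.

(** Without edges each vertex is treated alone, and no lower bound [2 <= m] is required. *)
Lemma extend_edgeless (G : graph) (k m : R) (W : vtx G -> Prop)
    (p : vtx G -> Rset) :
  k <= m -> frac_colorable G k -> (forall u v, ~ adj G u v) ->
  frac_precoloring G m W p -> precoloring_extends G m W p.
Proof.
  intros Hkm [c [Hc _]] Hno Hp.
  exists (fun v => if excluded_middle_informative (W v) then p v else c v).
  split; [split|].
  - intros v; destruct (excluded_middle_informative (W v)) as [H|H]; auto.
    destruct (Hc v) as (H1 & H2); split; [|exact H2].
    intros x Hx; apply H1 in Hx; lra.
  - intros u v H; destruct (Hno u v H).
  - intros v Hv x; destruct (excluded_middle_informative (W v)); tauto.
Qed.

(* The copy of the coloring leaves [setD (Ico 0 m) X], of measure [m - k],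
   unused. *)
Lemma uniform_coloring (G : graph) (k m : R) (c : vtx G -> Rset)
    (Ps : list Rset) :
  0 <= k <= m -> 0 < m -> frac_coloring G k c ->
  (forall P, In P Ps -> unit_set m P) ->
  exists (X : Rset) (c1 : vtx G -> Rset),
    bmeas X /\ subset X (Ico 0 m) /\ mu X = k /\
    (forall v, bmeas (c1 v) /\ subset (c1 v) X /\ mu (c1 v) = 1) /\
    (forall u v, adj G u v -> disjoint (c1 u) (c1 v)) /\
    (forall v P, In P Ps -> mu (setI (c1 v) P) = / m).
Proof.
  intros Hk Hm [Hc Hd] HPs.
  destruct (vtx_finite G) as [l Hl].
  assert (HI : forall t, 0 <= t -> bmeas (Ico 0 t)) by (auto using bmeas_Ico).
  assert (HPm : forall P, In P Ps -> lebesgue_measurable P)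
    by (intros; now apply HPs).
  destruct (uniform_subset Ps (Ico 0 m) (k / m)) as (X & HX & HXs & HXm & HXP);
    auto with real.
  { split; [apply Rle_mult_inv_pos; lra|].
    apply Rmult_le_reg_r with m; [lra|].
    unfold Rdiv; rewrite Rmult_assoc, Rinv_l; lra. }
  assert (HXk : mu X = k) by (rewrite HXm, mu_Ico; [field|]; lra).
  destruct (transport Ps (fun _ => / m) (map c l) (Ico 0 k) X)
    as (f & X' & F1 & F2 & F3 & F4 & F5 & F6); auto.
  - intros d Hd'; apply in_map_iff in Hd'; destruct Hd' as (v & <- & _).
    apply Hc.
  - apply HI; lra.
  - rewrite mu_Ico; lra.
  (* [P] has measure 1, so it meets [X] in measure [k / m], which is density [/ m] relative to
     [mu X = k]. *)
  - intros P HP; rewrite HXP, HXk by exact HP.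
    destruct (unit_set_bmeas m P ltac:(lra) (HPs P HP)) as (P1 & P2 & P3).
    replace (setI (Ico 0 m) P) with P; [rewrite P2; field; lra|].
    set_eq; specialize (P3 x); unfold Ico in P3; tauto.
  - assert (Hpull : forall v, bmeas (pull X' f (c v)) /\
        mu (pull X' f (c v)) = 1 /\ uniform Ps (fun _ => / m) (pull X' f (c v))).
    { intros v; destruct (F6 (c v)) as (A1 & A2 & A3);
        [apply in_map, Hl|].
      split; [exact A1|split; [|exact A3]]; rewrite A2.
      destruct (unit_set_bmeas k _ (proj1 Hk) (Hc v)) as (B1 & B2 & B3).
      rewrite <- B2; f_equal; set_eq; specialize (B3 x); unfold Ico in B3; tauto. }
    exists X, (fun v => pull X' f (c v)).
    split; [exact HX|split; [exact HXs|split; [exact HXk|split; [|split]]]].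
    + intros v; destruct (Hpull v) as (A1 & A2 & A3); repeat split;
        try apply A1; auto; intros x [Hx _]; apply F1, Hx.
    + intros u v Huv x [[_ H1] [_ H2]]; exact (Hd u v Huv _ (conj H1 H2)).
    + intros v P HP; destruct (Hpull v) as (A1 & A2 & A3).
      rewrite (A3 P HP), A2; ring.
Qed.

(* The recoloring near [W]: the rank is the distance to [W], truncated at 3.
   [A w] is a set of colors withdrawn from the vertices at distance two from [w]
   (where the unused colors [S w] replace it), so that the neighbors of [w] can
   use it in place of the colors of [p w]. *)
Inductive recolored (G : graph) (W : vtx G -> Prop) (p c : vtx G -> Rset)
    (A : vtx G -> Rset) (S : vtx G -> vtx G -> Rset) :
    nat -> vtx G -> Rset -> Prop :=
| recolored0 v : W v -> recolored G W p c A S 0 v (p v)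
| recolored1 v w : W w -> adj G w v ->
    recolored G W p c A S 1 v (setU (setD (c v) (p w)) (A w))
| recolored2 v w u : W w -> adj G w u -> adj G u v ->
    ~ W v -> (forall w', W w' -> ~ adj G w' v) ->
    recolored G W p c A S 2 v (setU (setD (c v) (A w)) (S w v))
| recolored3 v : ~ W v -> (forall w', W w' -> ~ adj G w' v) ->
    (forall w' u, W w' -> adj G w' u -> ~ adj G u v) ->
    recolored G W p c A S 3 v (c v).

Lemma recolored_exists (G : graph) (W : vtx G -> Prop) (p c A : vtx G -> Rset)
    (S : vtx G -> vtx G -> Rset) (v : vtx G) :
  exists C n, recolored G W p c A S n v C.
Proof.
  destruct (classic (W v)) as [H0|H0]; [do 2 eexists; now apply recolored0|].
  destruct (classic (exists w, W w /\ adj G w v)) as [(w & Hw & Hwv)|H1];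
    [do 2 eexists; eapply recolored1; eauto|].
  destruct (classic (exists w u, W w /\ adj G w u /\ adj G u v))
    as [(w & u & Hw & Hwu & Huv)|H2].
  - do 2 eexists; apply recolored2 with (w := w) (u := u); auto.
    intros w' Hw' Hwv'; eauto.
  - do 2 eexists; apply recolored3; auto.
    + intros w' Hw' Hwv; eauto.
    + intros w' u Hw' Hwu Huv; apply H2; eauto.
Qed.

(** * Correctness of the recoloring *)

Section Recoloring.

Variables (G : graph) (W : vtx G -> Prop) (p c A : vtx G -> Rset).
Variables (S : vtx G -> vtx G -> Rset) (m : R) (X : Rset).
Hypothesis HXs : subset X (Ico 0 m).
Hypothesis Hp : forall w, W w -> bmeas (p w) /\ subset (p w) (Ico 0 m)
  /\ mu (p w) = 1.
Hypothesis Hc : forall v, bmeas (c v) /\ subset (c v) X /\ mu (c v) = 1.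
Hypothesis Hcd : forall u v, adj G u v -> disjoint (c u) (c v).
Hypothesis Hcp : forall v w, W w -> mu (setI (c v) (p w)) = / m.
Hypothesis HA : forall w, W w -> bmeas (A w) /\ mu (A w) = / m
  /\ subset (A w) (setD (c w) (p w)).
(** The replacement restores exactly the measure a vertex loses, and it respects edges because two
    vertices at distance two from [w] may be adjacent. *)
Hypothesis HS : forall w, W w ->
  (forall v, bmeas (S w v) /\ mu (S w v) = mu (setI (A w) (c v))
             /\ subset (S w v) (setD (Ico 0 m) X)) /\
  (forall u v, adj G u v -> disjoint (S w u) (S w v)).
Hypothesis Htriangle : forall u v w,
  adj G u v -> adj G u w -> adj G v w -> False.
Hypothesis Hdist : forall w w', W w -> W w' -> w <> w' -> dist_ge G w w' 6.

(** Losses and gains balance. A neighbor of [w] trades measure [/ m] for [A w], which lies in [c w]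
    and so is disjoint from its own colors; at rank two the gain lies outside [X]. *)
Lemma recolored_unit (n : nat) (v : vtx G) (C : Rset) :
  recolored G W p c A S n v C ->
  bmeas C /\ mu C = 1 /\ subset C (Ico 0 m).
Proof.
  intros H.
  destruct (Hc v) as (C1 & C2 & C3).
  destruct H as [v Hv|v w Hw Hwv|v w u Hw Hwu Huv _ _|v _ _ _].
  - destruct (Hp v Hv) as (P1 & P2 & P3); auto.
  - destruct (Hp w Hw) as (P1 & P2 & P3).
    destruct (HA w Hw) as (A1 & A2 & A3).
    assert (Hb : bmeas (setD (c v) (p w))) by (apply bmeas_setD; auto; apply P1).
    split; [auto with bm|split].
    + rewrite mu_disjoint_union; auto.
      * rewrite A2; pose proof (mu_split (c v) (p w) C1 (proj1 P1)) as H.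
        rewrite Hcp, C3 in H by exact Hw; lra.
      * intros x [[Hx _] Hx']; apply A3 in Hx'; destruct Hx' as [Hx' _].
        exact (Hcd w v Hwv x (conj Hx' Hx)).
    + intros x [[Hx _]|Hx]; [apply HXs, C2, Hx|].
      apply A3 in Hx; destruct Hx as [Hx _]; apply HXs.
      exact (proj1 (proj2 (Hc w)) x Hx).
  - destruct (HA w Hw) as (A1 & A2 & A3).
    destruct (HS w Hw) as [HSv _]; destruct (HSv v) as (S1 & S2 & S3).
    assert (Hb : bmeas (setD (c v) (A w))) by (apply bmeas_setD; auto; apply A1).
    split; [auto with bm|split].
    + rewrite mu_disjoint_union; auto.
      * rewrite S2; pose proof (mu_split (c v) (A w) C1 (proj1 A1)) as H.
        replace (setI (A w) (c v)) with (setI (c v) (A w)) by set_eq; lra.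
      * intros x [[Hx _] Hx']; apply S3 in Hx'; apply (proj2 Hx'), C2, Hx.
    + intros x [[Hx _]|Hx]; [apply HXs, C2, Hx|apply S3 in Hx; apply Hx].
  - split; [exact C1|split; [exact C3|]]; intros x Hx; apply HXs, C2, Hx.
Qed.

Lemma close_eq (n : nat) (w w' : vtx G) :
  (n < 6)%nat -> W w -> W w' -> walk G n w w' -> w = w'.
Proof.
  intros Hlt Hw Hw' Hn; apply NNPP; intros Hne.
  specialize (Hdist w w' Hw Hw' Hne n Hn); lia.
Qed.

(** Ranks differing by more than one contradict the negative premises of the higher rank. Otherwise,
    when both ranks are at most two, a walk of length at most five identifies the nearby members of
    [W]. *)
Lemma recolored_disjoint_le (i j : nat) (u v : vtx G) (C D : Rset) :
  (i <= j)%nat -> adj G u v ->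
  recolored G W p c A S i u C -> recolored G W p c A S j v D -> disjoint C D.
Proof.
  intros Hij Huv HC HD.
  pose proof (adj_sym G u v Huv) as Hvu.
  pose proof (Hcd u v Huv) as Hd.
  destruct (Hc u) as (_ & Cu & _); destruct (Hc v) as (_ & Cv & _).
  destruct HC as [u Hu|u w Hw Hwu|u w u' Hw Hwu' Hu'u Hu0 Hu1|u Hu0 Hu1 Hu2];
    destruct HD as
      [v Hv|v z Hz Hzv|v z v' Hz Hzv' Hv'v Hv0 Hv1|v Hv0 Hv1 Hv2];
    try lia.
  - assert (u = v) as <- by
      (apply (close_eq 1 _ _ ltac:(lia)); auto; eapply walk_cons; [exact Huv|apply walk_nil]).
    destruct (adj_irrefl G u Huv).
  (* The neighbor has dropped [p u], and the set [A u] it received avoids [p u]. *)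
  - assert (u = z) as <-.
    { apply (close_eq 2 _ _ ltac:(lia)); auto.
      eapply walk_cons; [exact Huv|].
      eapply walk_cons; [apply adj_sym, Hzv|apply walk_nil]. }
    intros x [Hx [[_ Hn]|Hx']]; [auto|].
    apply (HA u Hu) in Hx'; apply Hx', Hx.
  - destruct (Hv1 u Hu Huv).
  - destruct (Hv1 u Hu Huv).
  - assert (w = z) as <-.
    { apply (close_eq 3 _ _ ltac:(lia)); auto.
      eapply walk_cons; [exact Hwu|].
      eapply walk_cons; [exact Huv|].
      eapply walk_cons; [apply adj_sym, Hzv|apply walk_nil]. }
    destruct (Htriangle w u v); auto.
  (* The only new conflict, over [A w], is avoided because [v] gave up [A w]; the colors [S w v] lie
     outside [X], which contains [c u] and [A w]. *)
  - assert (w = z) as <-.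
    { apply (close_eq 4 _ _ ltac:(lia)); auto.
      eapply walk_cons; [exact Hwu|].
      eapply walk_cons; [exact Huv|].
      eapply walk_cons; [apply adj_sym, Hv'v|].
      eapply walk_cons; [apply adj_sym, Hzv'|apply walk_nil]. }
    destruct (HS w Hw) as [HSv _]; destruct (HSv v) as (_ & _ & Sv).
    assert (HAX : subset (A w) X).
    { intros x Hx; apply (HA w Hw) in Hx; destruct Hx as [Hx _].
      exact (proj1 (proj2 (Hc w)) x Hx). }
    intros x [[[Hx _]|Hx] [[Hy Hy']|Hy]].
    + exact (Hd x (conj Hx Hy)).
    + apply Sv in Hy; apply (proj2 Hy), Cu, Hx.
    + auto.
    + apply Sv in Hy; apply (proj2 Hy), HAX, Hx.
  - destruct (Hv2 w u Hw Hwu Huv).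
  (* The walk through both second neighborhoods has length five: here the full distance six is
     needed. *)
  - assert (w = z) as <-.
    { apply (close_eq 5 _ _ ltac:(lia)); auto.
      eapply walk_cons; [exact Hwu'|].
      eapply walk_cons; [exact Hu'u|].
      eapply walk_cons; [exact Huv|].
      eapply walk_cons; [apply adj_sym, Hv'v|].
      eapply walk_cons; [apply adj_sym, Hzv'|apply walk_nil]. }
    destruct (HS w Hw) as [HSv HSd].
    destruct (HSv v) as (_ & _ & Sv); destruct (HSv u) as (_ & _ & Su).
    intros x [[[Hx _]|Hx] [[Hy _]|Hy]].
    + exact (Hd x (conj Hx Hy)).
    + apply Sv in Hy; apply (proj2 Hy), Cu, Hx.
    + apply Su in Hx; apply (proj2 Hx), Cv, Hy.
    + exact (HSd u v Huv x (conj Hx Hy)).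
  - destruct (HS w Hw) as [HSv _]; destruct (HSv u) as (_ & _ & Su).
    intros x [[[Hx _]|Hx] Hy].
    + exact (Hd x (conj Hx Hy)).
    + apply Su in Hx; apply (proj2 Hx), Cv, Hy.
  - exact Hd.
Qed.

Lemma recolored_extends : precoloring_extends G m W p.
Proof.
  assert (H : forall v, {C | exists n, recolored G W p c A S n v C}).
  { intros v; apply constructive_indefinite_description, recolored_exists. }
  exists (fun v => proj1_sig (H v)); split; [split|].
  - intros v; destruct (H v) as [C [n HC]]; simpl.
    destruct (recolored_unit n v C HC) as (H1 & H2 & H3).
    now apply bmeas_unit_set.
  - intros u v Huv; destruct (H u) as [C [i HC]], (H v) as [D [j HD]]; simpl.
    destruct (Nat.le_ge_cases i j) as [Hij|Hij].
    + exact (recolored_disjoint_le i j u v C D Hij Huv HC HD).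
    + intros x [Hx Hy].
      exact (recolored_disjoint_le j i v u D C Hij (adj_sym G u v Huv) HD HC x
        (conj Hy Hx)).
  - intros v Hv x; destruct (H v) as [C [n HC]]; simpl.
    destruct HC as [v _|v w Hw Hwv|v w u Hw Hwu Huv Hv0 Hv1|v Hv0 Hv1 Hv2];
      try contradiction; [tauto|].
    (* [recolored1] does not exclude [W v], but adjacent members of [W] would be too close. *)
    assert (w = v) as ->.
    { apply (close_eq 1 _ _ ltac:(lia)); auto; eapply walk_cons; [exact Hwv|apply walk_nil]. }
    destruct (adj_irrefl G v Hwv).
Qed.

End Recoloring.

(** * Choice of the withdrawn and replacement colors *)

Lemma extend_large (G : graph) (k m : R) (W : vtx G -> Prop)
    (p : vtx G -> Rset) :
  0 <= k -> k < 3 -> 2 <= m -> / m <= m - k -> frac_colorable G k ->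
  (forall w1 w2, W w1 -> W w2 -> w1 <> w2 -> dist_ge G w1 w2 6) ->
  frac_precoloring G m W p -> precoloring_extends G m W p.
Proof.
  intros Hk0 Hk3 Hm2 Heps [c0 Hc0] Hdist Hp.
  assert (Hinv : 0 < / m <= / 2).
  { split; [apply Rinv_0_lt_compat; lra|apply Rinv_le_contravar; lra]. }
  destruct (vtx_finite G) as [l Hl].
  (* Outside [W] the dummy value [[0, 1)] makes every entry of the list a unit set. *)
  pose (p' := fun v => if excluded_middle_informative (W v)
                       then p v else Ico 0 1).
  assert (Hp' : forall P, In P (map p' l) -> unit_set m P).
  { intros P HP; apply in_map_iff in HP; destruct HP as (v & <- & _).
    unfold p'; destruct (excluded_middle_informative (W v)); [auto|].
    apply bmeas_unit_set; [apply bmeas_Ico; lra|rewrite mu_Ico; lra|].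
    unfold Ico; intros x; lra. }
  destruct (uniform_coloring G k m c0 (map p' l))
    as (X & c & HX & HXs & HXk & Hc & Hcd & Hcp); auto; try lra.
  assert (Hcp' : forall v w, W w -> mu (setI (c v) (p w)) = / m).
  { intros v w Hw; rewrite <- (Hcp v (p' w)) by (apply in_map, Hl).
    unfold p'; destruct (excluded_middle_informative (W w)); tauto. }
  assert (Hpu : forall w, W w -> bmeas (p w) /\ subset (p w) (Ico 0 m)
                                 /\ mu (p w) = 1).
  { intros w Hw; destruct (unit_set_bmeas m (p w)) as (H1 & H2 & H3);
      auto; lra. }
  assert (HE : bmeas (setD (Ico 0 m) X)).
  { apply bmeas_setD; [apply bmeas_Ico; lra|apply HX]. }
  assert (HEm : mu (setD (Ico 0 m) X) = m - k).
  { rewrite mu_setD_subset, mu_Ico, HXk; auto; try lra.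
    apply bmeas_Ico; lra. }
  assert (Hg : forall w, {g : Rset * (vtx G -> Rset) | W w ->
    (bmeas (fst g) /\ mu (fst g) = / m
       /\ subset (fst g) (setD (c w) (p w))) /\
    (forall v, bmeas (snd g v) /\ mu (snd g v) = mu (setI (fst g) (c v))
       /\ subset (snd g v) (setD (Ico 0 m) X)) /\
    (forall u v, adj G u v -> disjoint (snd g u) (snd g v))}).
  { intros w; apply constructive_indefinite_description.
    destruct (classic (W w)) as [Hw|Hw];
      [|exists (fun _ => False, fun _ _ => False); tauto].
    destruct (Hpu w Hw) as (P1 & _ & P3).
    destruct (Hc w) as (C1 & C2 & C3).
    (* There is room because [1 - / m >= / m] when [2 <= m]. *)
    destruct (subset_of_measure (setD (c w) (p w)) (/ m)) as (A & A1 & A2 & A3).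
    { apply bmeas_setD; [exact C1|apply P1]. }
    { pose proof (mu_split (c w) (p w) C1 (proj1 P1)) as H.
      rewrite Hcp' in H by exact Hw; lra. }
    destruct (subset_of_measure (setD (Ico 0 m) X) (/ m) HE)
      as (E & E1 & E2 & E3); [lra|].
    destruct (copy_into (map c l) A E) as (f & E' & F1 & F2);
      auto; try congruence.
    { intros d Hd; apply in_map_iff in Hd; destruct Hd as (v & <- & _).
      apply Hc. }
    exists (A, fun v => pull E' f (c v)); intros _; simpl.
    split; [auto|split].
    - intros v; destruct (F2 (c v)) as [G1 G2]; [apply in_map, Hl|].
      split; [exact G1|split; [exact G2|]].
      intros x [Hx _]; apply E2, F1, Hx.
    - intros u v Huv x [[_ H1] [_ H2]]; exact (Hcd u v Huv _ (conj H1 H2)). }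
  apply (recolored_extends G W p c (fun w => fst (proj1_sig (Hg w)))
           (fun w => snd (proj1_sig (Hg w))) m X); auto.
  - intros w Hw; destruct (Hg w) as [g Hgw]; simpl; apply Hgw, Hw.
  - intros w Hw; destruct (Hg w) as [g Hgw]; simpl; apply Hgw, Hw.
  - intros u v w Huv Huw Hvw.
    pose proof (triangle_colorable_ge3 G k c0 u v w Hk0 Hc0 Huv Huw Hvw); lra.
Qed.

Theorem mainTheorem12 (k : Q) (eps : R) (G : graph) (W : vtx G -> Prop)
  (p : vtx G -> R -> Prop) :
  (0 < k)%Q -> (k < 3)%Q -> 0 < eps -> eps >= 1 / (Q2R k + eps) ->
  frac_colorable G (Q2R k) ->
  (forall w1 w2, W w1 -> W w2 -> w1 <> w2 -> dist_ge G w1 w2 6) ->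
  frac_precoloring G (Q2R k + eps) W p ->
  precoloring_extends G (Q2R k + eps) W p.
Proof.
  intros Hk0 Hk3 Heps Hge Hcol Hdist Hp.
  apply Qlt_Rlt in Hk0; apply Qlt_Rlt in Hk3.
  replace (Q2R 0) with 0 in Hk0 by (unfold Q2R; simpl; field).
  replace (Q2R 3) with 3 in Hk3 by (unfold Q2R; simpl; field).
  destruct (classic (exists u v, adj G u v)) as [(u & v & Huv)|Hno].
  - apply extend_large with (Q2R k); auto; try lra.
    destruct Hcol as [c Hc].
    pose proof (edge_colorable_ge2 G (Q2R k) c u v ltac:(lra) Hc Huv); lra.
  - apply extend_edgeless with (Q2R k); auto; [lra|].
    intros u v Huv; apply Hno; eauto.
Qed.
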